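(* Let $\alpha$ be a non-zero algebraic number and let $x\in(0,\infty]$. Then $$h_x(\alpha)=\begin{cases}h(\alpha)&\text{if }x\le 1,\\ 0&\text{if }x>1.\end{cases}$$
   Context: $\overline{\mathbb Q}^\times$ is the multiplicative group of non-zero algebraic numbers. For $f(z)=a\prod_{n=1}^N(z-\alpha_n)\in\mathbb C[z]$ with $a\neq 0$, the (logarithmic) Mahler measure is $M(f)=\log|a|+\sum_{n=1}^N\log^+|\alpha_n|$, where $\log^+ t=\max\{\log t,0\}$ (and $\log^+0=0$). For $\alpha\in\overline{\mathbb Q}^\times$, $M(\alpha)$ denotes the Mahler measure of the minimal polynomial of $\alpha$ over $\mathbb Z$ (primitive, irreducible, with integer coefficients). The Weil height of $\alpha$ is $h(\alpha)=M(\alpha)/\deg\alpha$, where $\deg\alpha=[\mathbb Q(\alpha):\mathbb Q]$. Let $\mathcal X(\overline{\mathbb Q}^\times)$ be the set of sequences $(\alpha_1,\alpha_2,\ldots)$ in $\overline{\mathbb Q}^\times$ with $\alpha_n=1$ for all but finitely many $n$, and $\tau(\alpha_1,\alpha_2,\ldots)=\prod_{n=1}^\infty\alpha_n$. For $x\in(0,\infty]$ put $h_x(\alpha_1,\alpha_2,\ldots)=\left(\sum_{n=1}^\infty h(\alpha_n)^x\right)^{1/x}$ if $x<\infty$ and $h_\infty(\alpha_1,\alpha_2,\ldots)=\max_{n\ge1}h(\alpha_n)$; for $\alpha\in\overline{\mathbb Q}^\times$, $h_x(\alpha)=\inf\{h_x(\bar\alpha):\bar\alpha\in\tau^{-1}(\alpha)\}$.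 *)

(* Defs.v *)
From HB Require Import structures.
From mathcomp Require Import all_boot all_order all_algebra.
From mathcomp Require Import all_classical all_reals all_analysis.
From mathcomp Require Import complex.

Set Implicit Arguments.
Unset Strict Implicit.
Unset Printing Implicit Defensive.

Import Order.TTheory GRing.Theory Num.Theory.
Import numFieldNormedType.Exports.
Local Open Scope classical_set_scope.
Local Open Scope ring_scope.

(* The complex numbers are R[i] for R : realType, and the field of algebraic
   numbers is the set of elements of R[i] that are algebraic over rat. *)
Definition algebraic_number (R : realType) (z : R[i]) : Prop :=
  algebraicOver (ratr : rat -> R[i]) z.

Definition cmod (R : realType) (z : R[i]) : R := complex.Re `|z|.

(* ln 0 = 0 in the library, so that logp 0 = 0. *)
Definition logp (R : realType) (t : R) : R := Num.max (ln t) 0.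

(* The roots of f, listed with multiplicity (meaningful for f != 0). *)
Definition croots (R : realType) (f : {poly R[i]}) : seq R[i] :=
  sval (closed_field_poly_normal f).

Definition mahler (R : realType) (f : {poly R[i]}) : R :=
  ln (cmod (lead_coef f)) + \sum_(z <- croots f) logp (cmod z).

(* Irreducibility as an element of the ring Z[X]. The library's
   irreducible_poly is irreducibility up to scalars, i.e., over Q. *)
Definition irreducible_polyZ (p : {poly int}) : Prop :=
  [/\ p != 0, p \isn't a GRing.unit &
      forall q r : {poly int}, p = q * r ->
        (q \is a GRing.unit) \/ (r \is a GRing.unit)].

(* zcontents carries the sign of the leading coefficient: zcontents p = 1 means
   that p is primitive with positive leading coefficient. *)
Definition is_minpolyZ (R : realType) (z : R[i]) (p : {poly int}) : Prop :=
  [/\ zcontents p = 1, irreducible_polyZ p & root (map_poly intr p) z].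

(* 0 if z is not algebraic. *)
Definition minpolyZ (R : realType) (z : R[i]) : {poly int} :=
  xget 0 [set p | is_minpolyZ z p].

Definition mahler_num (R : realType) (z : R[i]) : R :=
  mahler (map_poly intr (minpolyZ z)).

(* Q(z), the smallest subfield of the complex numbers that contains z. *)
Definition Qadjoin (R : realType) (z : R[i]) : set R[i] :=
  [set y | forall K : {pred R[i]}, divring_closed K -> z \in K -> y \in K].

Definition is_Qbasis (R : realType) (E : set R[i]) (n : nat)
    (b : 'I_n -> R[i]) : Prop :=
  [/\ forall i, E (b i),
      forall c : 'I_n -> rat, \sum_(i < n) ratr (c i) * b i = 0 ->
        forall i, c i = 0 &
      forall y, E y ->
        exists c : 'I_n -> rat, y = \sum_(i < n) ratr (c i) * b i].

(* The dimension of E over Q; 0 if there is no finite basis. *)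
Definition Qdim (R : realType) (E : set R[i]) : nat :=
  xget 0%N [set n | exists b : 'I_n -> R[i], is_Qbasis E b].

Definition alg_degree (R : realType) (z : R[i]) : nat := Qdim (Qadjoin z).

Definition weil_height (R : realType) (z : R[i]) : R :=
  mahler_num z / (alg_degree z)%:R.

Definition algseq (R : realType) : set (nat -> R[i]) :=
  [set a | (forall n, a n != 0 /\ algebraic_number (a n)) /\
           finite_set [set n | a n != 1]].

(* The product over a set is the finite product over the indices n for which
   a n != 1. *)
Definition tau (R : realType) (a : nat -> R[i]) : R[i] :=
  \big[*%R/1]_(n \in [set: nat]) a n.

(* For a in algseq R, the series has finitely many non-zero terms and the
   supremum is that of a finite non-empty set. *)
Definition height_seq (R : realType) (x : \bar R) (a : nat -> R[i]) : R :=
  match x with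
  | r%:E => limn (series (fun n => weil_height (a n) `^ r)) `^ r^-1
  | _ => sup (range (fun n => weil_height (a n)))
  end.

Definition metric_height (R : realType) (x : \bar R) (z : R[i]) : R :=
  inf [set height_seq x a | a in [set a | algseq a /\ tau a = z]].

(* Main.v *)
Require Import Defs.
From HB Require Import structures.
From mathcomp Require Import all_boot all_order all_algebra.
From mathcomp Require Import all_classical all_reals all_analysis.
From mathcomp Require Import complex.
From mathcomp Require Import all_field ring.
Import Order.TTheory GRing.Theory Num.Theory.
Import numFieldNormedType.Exports.
Local Open Scope ring_scope.

Set Implicit Arguments.
Unset Strict Implicit.
Unset Printing Implicit Defensive.

(* Let z = A(g) lie in a number field Q(g), let g_1, ..., g_N be the conjugates of
   g, and let f be the minimal polynomial of z over Z. Then f^k = L * prod_i (X - A(g_i))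
   with N = k deg z, so that N h(z) = log L + sum_i log^+ |A(g_i)|, and L divides
   every integer c for which c * prod_i (X - A(g_i)) has integral coefficients.

   If F = c * prod_i (X - x_i) has algebraic integers as coefficients, so does every
   F / (X - x_i); hence c times any subproduct of the x_i is an algebraic integer. It
   follows that c c' prod_i (X - x_i y_i) is integral when c prod_i (X - x_i) and
   c' prod_i (X - y_i) are. With a primitive element of Q(y, z) this yields
   h(yz) <= h(y) + h(z), and, with roots of unity for the y_i, n h(y) <= h(y^n).

   For x <= 1 the l^x norm dominates the l^1 norm, so subadditivity gives the lower
   bound h(alpha). For x > 1, n copies of an n-th root of alpha give a value at most
   n^(1/x - 1) h(alpha), which tends to 0. *)

(** * Polynomials with integral coefficients *)

Section IntegralPolynomials.
Variable (C : fieldType).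
Implicit Types (p q : {poly C}) (r c : C).

Definition integral_num (x : C) := integralOver (intr : int -> C) x.
Definition integral_coefs p := forall i, integral_num p`_i.

Lemma integral_numM x y : integral_num x -> integral_num y -> integral_num (x * y).
Proof. exact: integral_mul. Qed.

Lemma integral_numD x y : integral_num x -> integral_num y -> integral_num (x + y).
Proof. exact: integral_add. Qed.

Lemma integral_numN x : integral_num x -> integral_num (- x).
Proof. exact: integral_opp. Qed.

Lemma integral_num_nat n : integral_num n%:R.
Proof. exact: integral_nat. Qed.

Lemma integral_numX x n : integral_num x -> integral_num (x ^+ n).
Proof.
move=> hx; elim: n => [|n IH]; first exact: (integral_num_nat 1).
by rewrite exprS; apply: integral_numM.
Qed.

Lemma integral_coefsD p q :
  integral_coefs p -> integral_coefs q -> integral_coefs (p + q).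
Proof. by move=> hp hq i; rewrite coefD; apply: integral_numD. Qed.

Lemma integral_coefsM p q :
  integral_coefs p -> integral_coefs q -> integral_coefs (p * q).
Proof.
move=> hp hq i; rewrite coefM; elim/big_ind: _ => [|x y|j _].
- exact: (integral_num_nat 0).
- exact: integral_numD.
- exact: integral_numM.
Qed.

Lemma integral_coefsC c : integral_num c -> integral_coefs c%:P.
Proof. by move=> hc i; rewrite coefC; case: eqP => // _; apply: (integral_num_nat 0). Qed.

Lemma integral_coefsXn n : integral_coefs 'X^n.
Proof. by move=> i; rewrite coefXn; apply: integral_num_nat. Qed.

Lemma integral_coefsZ c p :
  integral_num c -> integral_coefs p -> integral_coefs (c *: p).
Proof. by move=> hc hp i; rewrite coefZ; apply: integral_numM. Qed.

Lemma integral_coefs_sum (I : Type) (s : seq I) (P : pred I) (F : I -> {poly C}) :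
  (forall i, P i -> integral_coefs (F i)) ->
  integral_coefs (\sum_(i <- s | P i) F i).
Proof.
move=> h; elim/big_ind: _ => //; [move=> i | exact: integral_coefsD].
by rewrite coef0; apply: (integral_num_nat 0).
Qed.

Lemma integral_coefs_prod (I : Type) (s : seq I) (P : pred I) (F : I -> {poly C}) :
  (forall i, P i -> integral_coefs (F i)) ->
  integral_coefs (\prod_(i <- s | P i) F i).
Proof.
move=> h; elim/big_ind: _ => //; [exact: (integral_coefsXn 0) |].
exact: integral_coefsM.
Qed.

Lemma integral_coefsXsubC x : integral_num x -> integral_coefs ('X - x%:P).
Proof.
move=> hx; apply: integral_coefsD; first exact: (integral_coefsXn 1).
by rewrite -polyCN; apply/integral_coefsC/integral_numN.
Qed.

Lemma integral_coefs_map_intr (p : {poly int}) :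
  integral_coefs (map_poly intr p).
Proof. by move=> i; rewrite coef_map; apply: integral_id. Qed.

Lemma integral_coefs_comp_Xn p n :
  integral_coefs p -> integral_coefs (p \Po 'X^n).
Proof.
move=> hp; rewrite comp_polyE; apply: integral_coefs_sum => i _.
by apply: integral_coefsZ => //; rewrite -exprM; apply: integral_coefsXn.
Qed.

(** For [p] of degree N + 1 with leading coefficient c, the polynomial c^N p(X/c) is monic, has
    integral coefficients and vanishes at c r; it is the [m] of the proof. *)
Lemma integral_lead_coef_mul_root p r :
  integral_coefs p -> root p r -> integral_num (lead_coef p * r).
Proof.
move=> hp rr; have [->|p0] := eqVneq p 0.
  by rewrite lead_coef0 mul0r; apply: (integral_num_nat 0).
set c := lead_coef p.
have hc : integral_num c by apply: hp.
have : (1 < size p)%N by apply: root_size_gt1 rr.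
case E : (size p) => [//|[//|N]] _.
pose m : {poly C} := \poly_(i < N.+2) (if i == N.+1 then 1 else p`_i * c ^+ (N - i)).
have sm : size m = N.+2 by rewrite size_poly_eq // eqxx oner_neq0.
apply: (@integral_root_monic _ _ _ _ m).
- by rewrite monicE lead_coefE sm coef_poly ltnSn eqxx.
- rewrite /root horner_poly big_ord_recr /= eqxx mul1r.
  move: rr; rewrite /root horner_coef E big_ord_recr /= => /eqP h.
  rewrite -[X in _ == X](mulr0 (c ^+ N)) -[X in _ == _ * X]h mulrDr big_distrr /=.
  apply/eqP; congr (_ + _).
    apply: eq_bigr => i _; rewrite ltn_eqF ?ltn_ord //.
    have -> : c ^+ N = c ^+ (N - i) * c ^+ i by rewrite -exprD subnK // -ltnS.
    by rewrite exprMn; ring.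
  by rewrite [in RHS](_ : p`_N.+1 = c) ?exprMn ?exprSr //; [ring | rewrite /c lead_coefE E].
- apply/integral_poly => i; rewrite coef_poly; case: ifP => _; last exact: (integral_num_nat 0).
  case: ifP => _; first exact: (integral_num_nat 1).
  by apply: integral_numM => //; apply: integral_numX.
Qed.

(** Induction on the size: removing the leading term c X^k of [q] changes the product by -c X^(k+1)
    + c r X^k. Both c and c r are integral, as c is also the leading coefficient of the product and
    [r] is one of its roots. *)
Lemma integral_coefs_divXsubC q r :
  integral_coefs (q * ('X - r%:P)) -> integral_coefs q.
Proof.
have [n] := ubnP (size q); elim: n q => // n IH q sq hq.
have [-> i|q0] := eqVneq q 0; first by rewrite coef0; apply: (integral_num_nat 0).
set c := lead_coef q; set k := (size q).-1.
have hc : integral_num c.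
  rewrite /c -[lead_coef q]mulr1 -(lead_coefXsubC r) -lead_coefM; exact: hq.
have hcr : integral_num (c * r).
  have := @integral_lead_coef_mul_root _ r hq.
  by rewrite lead_coefM lead_coefXsubC mulr1; apply; rewrite rootM root_XsubC eqxx orbT.
have -> : q = (q - c *: 'X^k) + c *: 'X^k by rewrite subrK.
apply: integral_coefsD; last by apply: integral_coefsZ => //; apply: integral_coefsXn.
apply: IH.
  apply: leq_ltn_trans (_ : (k < n)%N); last by rewrite -ltnS -polySpred.
  apply/leq_sizeP => j; rewrite leq_eqVlt => /orP[/eqP <-|hj].
    by rewrite coefB coefZ coefXn eqxx mulr1 subrr.
  rewrite coefB coefZ coefXn gtn_eqF // mulr0 subr0 nth_default //.
  by rewrite polySpred.
rewrite mulrBl; apply: integral_coefsD => //.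
have -> : - (c *: 'X^k * ('X - r%:P)) = (-1) *: (c *: 'X^(k.+1)) + (c * r) *: 'X^k.
  by rewrite mulrBr opprB -!mul_polyC polyCN !polyCM exprSr; ring.
apply: integral_coefsD; apply: integral_coefsZ => //; try exact: integral_coefsXn.
  exact/integral_numN/(integral_num_nat 1).
by apply: integral_coefsZ => //; apply: integral_coefsXn.
Qed.

Lemma integral_coefs_div_prod (I : Type) (s : seq I) (P : pred I) (x : I -> C) q :
  integral_coefs (q * \prod_(i <- s | P i) ('X - (x i)%:P)) -> integral_coefs q.
Proof.
elim: s q => [|i s IH] q; first by rewrite big_nil mulr1.
rewrite big_cons; case: ifP => _; last exact: IH.
by rewrite mulrA => /IH /integral_coefs_divXsubC.
Qed.

(** Dividing out the factors outside [S] keeps the coefficients integral and leaves the wanted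
    number, up to sign, as constant term. *)
Lemma integral_subprod (I : finType) (x : I -> C) c (S : pred I) :
  integral_coefs (c *: \prod_i ('X - (x i)%:P)) ->
  integral_num (c * \prod_(i | S i) x i).
Proof.
rewrite (bigID S) /= scalerAl => /integral_coefs_div_prod /(_ 0%N).
rewrite coefZ -horner_coef0 horner_prod.
under eq_bigr do rewrite hornerXsubC sub0r.
rewrite prodrN /= mulrCA => h.
rewrite -(signrMK #|S| (c * _)); apply: integral_numM => //.
by apply/integral_numX/integral_numN/(integral_num_nat 1).
Qed.

(** Expand over the set [J] of indices that contribute X. Up to sign, each coefficient is c prod x_i
    times c' prod y_i, both products over the complement of [J], and [integral_subprod] applies to
    each. *)
Lemma integral_coefs_prodM (I : finType) (x y : I -> C) c c' :
  integral_coefs (c *: \prod_i ('X - (x i)%:P)) ->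
  integral_coefs (c' *: \prod_i ('X - (y i)%:P)) ->
  integral_coefs ((c * c') *: \prod_i ('X - (x i * y i)%:P)).
Proof.
move=> hx hy.
rewrite bigA_distr scaler_sumr; apply: integral_coefs_sum => J _.
rewrite (bigID (mem J)) /=.
rewrite (eq_bigr (fun _ => 'X)); last by move=> i ->.
rewrite [X in _ *: (_ * X)](eq_bigr (fun i => (- (x i * y i))%:P)); last first.
  by move=> i /negPf->; rewrite polyCN.
rewrite -rmorph_prod prodrN big_split /= prodr_const -mul_polyC mulrCA -polyCM.
apply: integral_coefsM; first exact: integral_coefsXn.
apply: integral_coefsC; rewrite mulrCA mulrACA.
apply: integral_numM; first by apply/integral_numX/integral_numN/(integral_num_nat 1).
by apply: integral_numM; apply: integral_subprod.
Qed.

(** Substituting X^n for X splits each X^n - x_i^n into factors X - x_i w_j. Multiplying these roots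
    by the integral numbers w_j^-1, with [integral_coefs_prodM], turns them into x_i, each repeated
    n times. *)
Lemma integral_coefs_prod_roots (I : finType) (x : I -> C) c n :
  (0 < n)%N -> (exists w : 'I_n -> C, 'X^n - 1 = \prod_j ('X - (w j)%:P)) ->
  integral_coefs (c *: \prod_i ('X - (x i ^+ n)%:P)) ->
  integral_coefs (c *: (\prod_i ('X - (x i)%:P)) ^+ n).
Proof.
move=> n0 [w hw] hc.
have wn j : w j ^+ n = 1.
  apply/eqP; rewrite -subr_eq0; have := congr1 (horner^~ (w j)) hw.
  rewrite !hornerE horner_prod (bigD1 j) //= !hornerE subrr mul0r => ->//.
have w0 j : w j != 0.
  by apply/eqP => E; have /eqP := wn j; rewrite E expr0n gtn_eqF // eq_sym oner_eq0.
have factor (g : C) : 'X^n - (g ^+ n)%:P = \prod_j ('X - (g * w j)%:P).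
  have [->|g0] := eqVneq g 0.
    rewrite expr0n gtn_eqF // subr0; under eq_bigr do rewrite mul0r subr0.
    by rewrite prodr_const card_ord.
  (* Substitute X/g in the factorization of X^n - 1 and distribute g^n over the n factors. *)
  have := congr1 (fun p => g ^+ n *: (p \Po (g^-1 *: 'X))) hw.
  rewrite comp_polyB comp_polyC comp_Xn_poly rmorph_prod /=.
  rewrite scalerBr exprZn scalerA -exprMn mulfV // expr1n scale1r alg_polyC => ->.
  have -> : g ^+ n = \prod_(j < n) g by rewrite prodr_const card_ord.
  rewrite -scaler_prod; apply: eq_bigr => j _.
  by rewrite comp_polyB comp_polyX comp_polyC scalerBr scalerA mulfV // scale1r -mul_polyC -polyCM.
have h1 : integral_coefs (c *: \prod_(u : I * 'I_n) ('X - (x u.1 * w u.2)%:P)).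
  have := integral_coefs_comp_Xn n hc.
  rewrite comp_polyZ rmorph_prod /= -(pair_bigA _ (fun i j => 'X - (x i * w j)%:P)) /=.
  under eq_bigr do rewrite comp_polyB comp_polyX comp_polyC factor.
  by [].
have h2 : integral_coefs (1 *: \prod_(u : I * 'I_n) ('X - ((w u.2)^-1)%:P)).
  rewrite scale1r; apply: integral_coefs_prod => u _.
  apply: integral_coefsXsubC; move: (w u.2) (wn u.2) (w0 u.2) => v vn v0.
  have -> : v^-1 = v ^+ n.-1.
    by apply: (mulIf v0); rewrite mulVf // -exprSr prednK.
  apply: integral_numX; apply: (@integral_root_monic _ _ _ _ ('X^n - 1)).
  - by rewrite -polyC1 monicXnsubC.
  - by rewrite /root !hornerE vn subrr.
  - apply/integral_poly => i; rewrite coefB coefXn coef1.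
    by apply: integral_numD; last apply: integral_numN; apply: integral_num_nat.
have := integral_coefs_prodM h1 h2; rewrite mulr1.
rewrite -(pair_bigA _ (fun i j => 'X - (x i * w j / w j)%:P)) /=.
rewrite -prodrXl; congr (integral_coefs (_ *: _)); apply: eq_bigr => i _.
under eq_bigr do rewrite mulfK //.
by rewrite prodr_const card_ord.
Qed.

End IntegralPolynomials.

(** * Minimal polynomials and conjugates *)

Section RationalPolynomials.
Variable C : numClosedFieldType.
Local Notation pZtoC := (map_poly (intr : int -> C)).
Local Notation pZtoQ := (map_poly (intr : int -> rat)).
Local Notation pQtoC := (map_poly (ratr : rat -> C)).

Lemma map_ratr_intr (p : {poly int}) : pQtoC (pZtoQ p) = pZtoC p.
Proof. by rewrite -map_poly_comp; apply: eq_map_poly => z /=; rewrite ratr_int. Qed.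

(** By Gauss's lemma, X - q is proportional to some [p1] that divides a monic polynomial over Z. So
    [p1] has leading coefficient 1 or -1, and q is read off from its constant term. *)
Lemma integral_rat_int (q : rat) :
  integral_num (ratr q : C) -> exists z : int, q = z%:~R.
Proof.
case=> p mp; rewrite -map_ratr_intr fmorph_root -dvdp_XsubCl.
case/dvdpP_rat_int => p1 [a a0 E] [r Er].
have l1 : lead_coef p1 * lead_coef r = 1 by rewrite -lead_coefM -Er (monicP mp).
have : lead_coef p1 \is a GRing.unit by apply/unitrPr; exists (lead_coef r).
have := congr1 lead_coef E.
rewrite lead_coefXsubC lead_coefZ lead_coef_map_inj //; last exact: intr_inj.
have := congr1 (coefp 0) E.
rewrite /= coefB coefX coefC coefZ coef_map /= sub0r => /(congr1 -%R); rewrite opprK => ->.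
move=> al /orP[] /eqP h; move: al; rewrite h.
  by rewrite mulr1 => <-; exists (- p1`_0); rewrite mul1r rmorphN.
by rewrite mulrN mulr1 => /(congr1 -%R); rewrite opprK => <-; exists (p1`_0); rewrite mulN1r opprK.
Qed.

Lemma integral_coefs_rat_int (p : {poly rat}) :
  integral_coefs (pQtoC p) -> exists q : {poly int}, p = pZtoQ q.
Proof.
move=> h; exists (map_poly Num.floor p); apply/polyP => i.
have [z Ez] : exists z : int, p`_i = z%:~R.
  by apply: integral_rat_int; move: (h i); rewrite coef_map.
by rewrite coef_map coef_map_id0 ?floor0 // Ez /= intrKfloor.
Qed.

(** Gauss's lemma rescales a rational factor to a factor over Z. The root excludes the prime
    constants, which are also irreducible over Z. *)
Lemma irreducible_polyZ_rat (p : {poly int}) (z : C) :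
  irreducible_polyZ p -> root (pZtoC p) z -> irreducible_poly (pZtoQ p).
Proof.
case=> p0 _ pirr rz.
have rz' : root (pQtoC (pZtoQ p)) z by rewrite map_ratr_intr.
have p0' : pZtoQ p != 0 by rewrite -size_poly_eq0 size_rat_int_poly size_poly_eq0.
split.
  rewrite -(size_map_poly (ratr : {rmorphism rat -> C})) (root_size_gt1 _ rz') //.
  by rewrite map_poly_eq0.
move=> q q1 /[dup] qp /dvdpP_rat_int[p1 [a a0 Eq] [r Er]].
rewrite -(dvdp_size_eqp qp) Eq size_scale // !size_rat_int_poly.
have sp1 : size p1 != 1%N by rewrite -size_rat_int_poly -(size_scale _ a0) -Eq.
have [] := pirr _ _ Er; rewrite poly_unitE; first by rewrite (negPf sp1).
case/andP=> /size_poly1P[b b0 Eb] _.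
by rewrite Er Eb mulrC mul_polyC size_scale.
Qed.

Lemma irreducible_dvd_root (m q : {poly rat}) (z : C) :
  irreducible_poly m -> root (pQtoC m) z -> root (pQtoC q) z -> m %| q.
Proof.
move=> mirr mz qz; apply: contraLR qz; rewrite -irreducible_poly_coprime //.
by move=> cop; apply: (coprimep_root _ mz); rewrite coprimep_map.
Qed.

(** Any root of [P] is a root of [p], so [p] divides [P], and the cofactor inherits the hypotheses;
    the induction ends at a constant. *)
Lemma irreducible_power (P p : {poly rat}) :
  irreducible_poly p -> P != 0 ->
  (forall z : C, root (pQtoC P) z -> root (pQtoC p) z) ->
  exists k c, P = c *: p ^+ k.
Proof.
move=> pirr; have [n] := ubnP (size P); elim: n P => // n IH P sP P0 hP.
have [sP1|sP1] := eqVneq (size P) 1%N.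
  have /eqP/size_poly1P[c c0 ->] := sP1.
  by exists 0%N, c; rewrite expr0 alg_polyC.
have [z rz] : exists z : C, root (pQtoC P) z.
  by apply/closed_rootP; rewrite size_map_poly.
have /dvdpP[Q EQ] := irreducible_dvd_root pirr (hP _ rz) rz.
have Q0 : Q != 0 by apply: contraNneq P0 => Q0; rewrite EQ Q0 mul0r.
have p0 := irredp_neq0 pirr.
have [||y ry|k [c Ec]] := IH Q => //.
- apply: leq_trans (_ : (size Q < size P)%N) _; last by rewrite -ltnS.
  rewrite EQ size_mul //; case: (size p) pirr.1 => [|[|j]] // _.
  by rewrite !addnS /= ltnS leq_addr.
- by apply: hP; rewrite EQ rmorphM rootM ry.
- by exists k.+1, c; rewrite EQ Ec exprSr scalerAl.
Qed.

(** Splitting a polynomial B into linear factors gives det B(M) = prod B(g). Taking B = x - A shows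
    that both sides agree at every point x, hence are equal. *)
Lemma char_poly_horner_mx n (M : 'M[C]_n.+1) (s : seq C) (A : {poly C}) :
  char_poly M = \prod_(g <- s) ('X - g%:P) ->
  char_poly (horner_mx M A) = \prod_(g <- s) ('X - (A.[g])%:P).
Proof.
move=> hM.
have evalchar (B : 'M[C]_n.+1) x : (char_poly B).[x] = \det (x%:M - B).
  rewrite /char_poly -[_.[x]]/(horner_eval x _) -det_map_mx; congr (\det _).
  by apply/matrixP => i j; rewrite !mxE /= rmorphB rmorphMn /= /horner_eval hornerX hornerC.
have ss : size s = n.+1.
  by apply/eqP; rewrite -eqSS -(size_prod_XsubC s id) -hM size_char_poly.
have constE (c : C) : \prod_(g <- s) c = c ^+ n.+1.
  by rewrite big_const_seq count_predT iter_mulr_1 ss.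
have detB (B : {poly C}) : \det (horner_mx M B) = \prod_(g <- s) B.[g].
  have [t ->] := closed_field_poly_normal B.
  rewrite linearZ /= detZ rmorph_prod /=.
  under [RHS]eq_bigr do rewrite hornerZ horner_prod.
  rewrite big_split /= constE; congr (_ * _).
  rewrite exchange_big /= (big_morph _ (@det_mulmx _ _) (@det1 _ _)) /=.
  apply: eq_bigr => d _; rewrite rmorphB /= horner_mx_X horner_mx_C.
  rewrite -[M - _]opprB -scaleN1r detZ -evalchar hM horner_prod -constE -big_split /=.
  by apply: eq_bigr => g _; rewrite !hornerE mulN1r opprB.
apply/eqP; rewrite -subr_eq0; apply: contraT => /closed_nonrootP[x].
rewrite /root !hornerE evalchar horner_prod.
rewrite -(horner_mx_C M x) -rmorphB detB.
under eq_bigr do rewrite !hornerE.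
by under [X in _ - X]eq_bigr do rewrite !hornerE; rewrite subrr eqxx.
Qed.

(** The witness is the characteristic polynomial of A(M), where M is the companion matrix of [m] and
    so has rational entries. *)
Lemma rational_prod_horner (m A : {poly rat}) (s : seq C) :
  m \is monic -> (1 < size m)%N -> pQtoC m = \prod_(g <- s) ('X - g%:P) ->
  exists P : {poly rat}, pQtoC P = \prod_(g <- s) ('X - ((pQtoC A).[g])%:P).
Proof.
move=> mm sm Em.
have [n [M EM]] : exists n (M : 'M[rat]_n.+1), char_poly M = m.
  (* [horner_mx] expects a matrix of size n + 1; [sm] excludes size 0. *)
  move: (companionmxK mm); move: (companionmx m); case: (size m).-1 => [M hM|n M hM].
    by move: sm; rewrite -hM size_char_poly.
  by exists n, M.
exists (char_poly (horner_mx M A)).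
by rewrite map_char_poly map_horner_mx (char_poly_horner_mx _ (s := s)) // -map_char_poly EM.
Qed.

Lemma minpoly_exists (z : C) : algebraicOver (ratr : rat -> C) z ->
  exists m : {poly rat}, [/\ m \is monic, irreducible_poly m & root (pQtoC m) z].
Proof.
move/integral_algebraic/(minPoly_decidable_closure (fun y => pselect _)).
by case=> m [? ? ?]; exists m.
Qed.

(** As [m] and f(A) share the root z, every A(g) is a root of f. The product is rational, hence a
    constant multiple of a power of f, and leading coefficients determine the constant. *)
Lemma conjugates_power (f : {poly int}) (m A : {poly rat}) (s : seq C) (z : C) :
  zcontents f = 1 -> irreducible_poly (pZtoQ f) ->
  m \is monic -> irreducible_poly m ->
  root (pQtoC m) z -> root (pZtoC f) (pQtoC A).[z] ->
  pQtoC m = \prod_(g <- s) ('X - g%:P) ->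
  exists k, pZtoC f ^+ k =
    ((lead_coef f)%:~R ^+ k) *: \prod_(g <- s) ('X - ((pQtoC A).[g])%:P).
Proof.
move=> f1 firr mm mirr mz fz Em.
have [P EP] := rational_prod_horner A mm mirr.1 Em.
have fA : m %| (pZtoQ f \Po A).
  apply: (irreducible_dvd_root mirr mz).
  by rewrite map_comp_poly /root horner_comp map_ratr_intr.
have lead1 : lead_coef P = 1.
  apply: (fmorph_inj (ratr : {rmorphism rat -> C})).
  by rewrite -lead_coef_map EP lead_coef_prod_XsubC rmorph1.
have [||k [c Ec]] := irreducible_power (P := P) firr.
- by rewrite -lead_coef_eq0 lead1 oner_neq0.
- move=> x; rewrite EP -(big_map _ predT (fun y => 'X - y%:P)) root_prod_XsubC.
  case/mapP => g gs ->; have : root (pQtoC (pZtoQ f \Po A)) g.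
    by have /dvdpP[r ->] := fA; rewrite rmorphM rootM /= Em root_prod_XsubC gs orbT.
  by rewrite map_comp_poly /root horner_comp.
exists k; rewrite -EP Ec linearZ /= rmorphXn /= map_ratr_intr scalerA.
move: lead1; rewrite Ec lead_coefZ lead_coef_exp lead_coef_map_inj //; last exact: intr_inj.
move=> /(congr1 (ratr : rat -> C)); rewrite rmorphM rmorphXn /= ratr_int rmorph1 mulrC => ->.
by rewrite scale1r.
Qed.

(** With l the leading coefficient, c Q^n = (c / l^(kn)) f^(kn) is rational with algebraic integers
    as coefficients, so it lies in Z[X]. Since f^(kn) is primitive, c is l^(kn) times the content of
    that polynomial. *)
Lemma primitive_lead_dvd (f : {poly int}) (Q : {poly C}) k n (c : int) :
  zcontents f = 1 -> pZtoC f ^+ k = ((lead_coef f)%:~R ^+ k) *: Q ->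
  integral_coefs (c%:~R *: Q ^+ n) -> (lead_coef f ^+ (k * n) %| c)%Z.
Proof.
move=> f1 E; set l := lead_coef f.
have l0 : l != 0 by rewrite lead_coef_eq0; apply: contra_eq_neq f1 => ->; rewrite zcontents0.
pose a : rat := (l ^+ (k * n))%:~R.
have a0 : a != 0 by rewrite intr_eq0 expf_neq0.
have -> : c%:~R *: Q ^+ n = pQtoC ((c%:~R / a) *: pZtoQ (f ^+ (k * n))).
  rewrite linearZ /= map_ratr_intr rmorphXn /= exprM E exprZn scalerA fmorph_div /= !ratr_int.
  by rewrite -exprM rmorphXn /= mulfVK // -rmorphXn /= intr_eq0 expf_neq0.
case/integral_coefs_rat_int => F EF.
have E2 : l ^+ (k * n) *: F = c *: f ^+ (k * n).
  apply: (map_inj_poly (f := intr : int -> rat)); [exact: intr_inj | by [] |].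
  by rewrite /= !linearZ /= -EF scalerA mulrCA mulfV // mulr1.
have cf j : zcontents (f ^+ j) = 1.
  by elim: j => [|j IH]; rewrite ?exprS ?zcontentsM ?f1 ?IH // zcontents_monic ?monic1.
have := congr1 zcontents E2; rewrite !zcontentsZ cf mulr1 => <-.
by rewrite dvdz_mulr.
Qed.

End RationalPolynomials.

(** * Minimal polynomials over Z and degrees over Q *)

Section MinimalPolynomial.
Variable R : realType.
Local Notation C := (R[i]).
Local Notation pZtoC := (map_poly (intr : int -> C)).
Local Notation pZtoQ := (map_poly (intr : int -> rat)).
Local Notation pQtoC := (map_poly (ratr : rat -> C)).

Lemma unit_polyZ_contents (p : {poly int}) :
  size p = 1%N -> zcontents p \is a GRing.unit -> p \is a GRing.unit.
Proof.
move=> sp; have /eqP/size_poly1P[c c0 Ec] := sp.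
by rewrite poly_unitE sp /= Ec -{1}(mulr1 c%:P) mul_polyC zcontentsZ
  zcontents_monic ?monic1 // mulr1 coefC eqxx.
Qed.

(** Clear denominators in the rational minimal polynomial and take the primitive part. In a
    factorization over Z one factor is constant by irreducibility over Q, and it is a unit because
    the contents multiply to 1. *)
Lemma minpolyZP (z : C) : algebraic_number z -> is_minpolyZ z (minpolyZ z).
Proof.
move=> /minpoly_exists[m [mm mirr mz]].
apply: (@xgetPex _ 0 [set p | is_minpolyZ z p]).
have [q [a a0 Em]] := rat_poly_scale m.
have q0 : q != 0.
  by apply: contraTneq (monic_neq0 mm) => q0; rewrite Em q0 map_poly0 scaler0 negbK.
pose p := zprimitive q.
have Ep : pZtoQ p %= m.
  have := zpolyEprim q; rewrite -/p => Eq.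
  rewrite Em Eq linearZ /= scalerA eqp_sym eqp_scale // mulf_neq0 //.
    by rewrite invr_eq0 intr_eq0.
  by rewrite intr_eq0 zcontents_eq0.
have sp : size p = size m by rewrite -(size_rat_int_poly p) (eqp_size Ep).
exists p; split.
- by rewrite /p zcontents_primitive q0.
- split.
  + by rewrite /p zprimitive_eq0.
  + by rewrite poly_unitE sp; case: (size m) mirr.1 => [|[]].
  + move=> u v E.
    have : zcontents u * zcontents v = 1 by rewrite -zcontentsM -E zcontents_primitive q0.
    move=> uv; have uu : zcontents u \is a GRing.unit by apply/unitrPr; exists (zcontents v).
    have vu : zcontents v \is a GRing.unit by apply/unitrPr; exists (zcontents u); rewrite mulrC.
    have u0 : u != 0.
      by apply/eqP => h; move: uv; rewrite h zcontents0 mul0r => /eqP; rewrite eq_sym oner_eq0.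
    have [su|su] := eqVneq (size u) 1%N; first by left; apply: unit_polyZ_contents.
    right; apply: unit_polyZ_contents => //.
    have /eqp_size : pZtoQ u %= m.
      apply: mirr; first by rewrite size_rat_int_poly.
      by rewrite -(eqp_dvdr _ Ep) E rmorphM dvdp_mulr.
    rewrite size_rat_int_poly -sp E size_mul.
    * move: u0; rewrite -size_poly_gt0; case: (size u) => // i _.
      by rewrite addSn /= => h; apply/eqP; rewrite -(eqn_add2l i) addn1 -h.
    * exact: u0.
    * by apply/eqP => h; move: uv; rewrite h zcontents0 mulr0 => /eqP; rewrite eq_sym oner_eq0.
- have : m %| pZtoQ p by rewrite (eqp_dvdr m Ep).
  by case/dvdpP => r Er; rewrite -map_ratr_intr Er rmorphM rootM /= mz orbT.
Qed.

(** The values q(z) form a field: if b(z) is non-zero, then b is coprime to f, and a Bezout relation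
    evaluated at z inverts b(z). *)
Lemma QadjoinP (z : C) (f : {poly rat}) : irreducible_poly f -> root (pQtoC f) z ->
  forall y, Qadjoin z y <-> exists q, y = (pQtoC q).[z].
Proof.
move=> firr fz y; split; last first.
  case=> q -> K hK zK.
  pose mK := GRing.isDivringClosed.Build C K hK.
  pose K' : divringClosed C := HB.pack K mK.
  rewrite -[K]/(K' : {pred C}) horner_coef rpred_sum // => i _.
  by rewrite coef_map rpredM ?rpred_rat // rpredX.
pose K : {pred C} := fun y => `[< exists q, y = (pQtoC q).[z] >].
have KE t : reflect (exists q, t = (pQtoC q).[z]) (t \in K) by exact: asboolP.
move=> /(_ K) h; apply/KE/h; last by apply/KE; exists 'X; rewrite map_polyX hornerX.
split=> [|_ _ /KE[a ->] /KE[b ->]|_ _ /KE[a ->] /KE[b ->]].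
- by apply/KE; exists 1; rewrite rmorph1 hornerC.
- by apply/KE; exists (a - b); rewrite rmorphB !hornerE.
apply/KE; have [b0|b0] := eqVneq (pQtoC b).[z] 0.
  by exists 0; rewrite b0 invr0 mulr0 rmorph0 horner0.
have : coprimep f b.
  rewrite irreducible_poly_coprime //; apply: contraNN b0 => /dvdpP[r ->].
  by rewrite rmorphM hornerM /= (eqP fz) mulr0.
case/Bezout_coprimepP => -[u v] /= /eqpP[[c1 c2] /= /andP[c10 c20]].
move=> /(congr1 pQtoC); rewrite alg_polyC -[c1 *: _]mul_polyC.
rewrite rmorphM rmorphD !rmorphM /= !map_polyC /=.
move=> /(congr1 (horner^~ z)); rewrite !hornerE (eqP fz) mulr0 add0r => E.
have r2 : (ratr c2 : C) != 0 by rewrite fmorph_eq0.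
have : ratr (c1 / c2) * ((pQtoC v).[z] * (pQtoC b).[z]) = 1 :> C.
  by rewrite fmorph_div mulrAC E mulfV.
move: (c1 / c2) => w Ew; exists (a * (w%:P * v)).
rewrite !rmorphM /= map_polyC !hornerM hornerC; congr (_ * _).
by apply: (mulIf b0); rewrite mulVf // -mulrA Ew.
Qed.

(** The two change-of-basis matrices, n by m and m by n, multiply to the identity of size n, which
    bounds n by the rank. *)
Lemma Qbasis_le (E : set C) n (b : 'I_n -> C) m (b' : 'I_m -> C) :
  is_Qbasis E b -> is_Qbasis E b' -> (n <= m)%N.
Proof.
move=> [bE bfree bgen] [b'E b'free b'gen].
have /boolp.choice[A EA] i := b'gen _ (bE i).
have /boolp.choice[B EB] j := bgen _ (b'E j).
pose MA := \matrix_(i, j) A i j; pose MB := \matrix_(j, k) B j k.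
apply: (@mulmx1_min rat n m MA MB); apply/matrixP => i k.
have : \sum_k ratr ((MA *m MB) i k - (1%:M : 'M[rat]_n) i k) * b k = 0.
  under eq_bigr do rewrite rmorphB mulrBl.
  rewrite sumrB; apply/eqP; rewrite subr_eq0; apply/eqP.
  rewrite [RHS](bigD1 i) //= [X in _ + X]big1 => [|l li]; last first.
    by rewrite mxE eq_sym (negPf li) rmorph0 mul0r.
  rewrite addr0 mxE eqxx rmorph1 mul1r [RHS]EA.
  under [RHS]eq_bigr do rewrite EB mulr_sumr.
  rewrite exchange_big /=; apply: eq_bigr => l _.
  rewrite mxE rmorph_sum mulr_suml; apply: eq_bigr => j _.
  by rewrite !mxE rmorphM mulrA.
by move/bfree/(_ k)/eqP; rewrite subr_eq0 => /eqP.
Qed.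

Lemma alg_degreeE (z : C) (f : {poly rat}) :
  irreducible_poly f -> root (pQtoC f) z -> alg_degree z = (size f).-1.
Proof.
move=> firr fz; set d := (size f).-1.
have sf : size f = d.+1 by rewrite prednK // size_poly_gt0 irredp_neq0.
have evalE (c : nat -> rat) :
    (pQtoC (\poly_(i < d) c i)).[z] = \sum_(i < d) ratr (c i) * z ^+ i.
  rewrite (@horner_coef_wide _ d) ?size_map_poly ?size_poly //.
  by apply: eq_bigr => i _; rewrite coef_map coef_poly ltn_ord.
have basis : is_Qbasis (Qadjoin z) (fun i : 'I_d => z ^+ i).
  split=> [i|c E i|y /(QadjoinP firr fz)[q ->]].
  - by apply/(QadjoinP firr fz); exists 'X^i; rewrite map_polyXn hornerXn.
  - pose c' (j : nat) := if insub j is Some i then c i else 0.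
    have c'E (j : 'I_d) : c' j = c j by rewrite /c' valK.
    have r0 : root (pQtoC (\poly_(j < d) c' j)) z.
      rewrite /root evalE; apply/eqP; rewrite -[RHS]E.
      by apply: eq_bigr => j _; rewrite c'E.
    have /eqP p0 : \poly_(j < d) c' j == 0.
      apply: contraTT (irreducible_dvd_root firr fz r0) => p0.
      by apply: contraTN (size_poly d c') => /(dvdp_leq p0); rewrite sf -ltnNge.
    by have := congr1 (coefp i) p0; rewrite /= coef_poly ltn_ord coef0 c'E.
  - exists (fun i => (q %% f)`_i); rewrite -evalE.
    have -> : \poly_(i < d) (q %% f)`_i = q %% f.
      apply/polyP => i; rewrite coef_poly; case: ltnP => // di.
      by rewrite nth_default // (leq_trans _ di) // -ltnS -sf ltn_modp irredp_neq0.
    by rewrite {1}(divp_eq q f) rmorphD rmorphM hornerD hornerM /= (eqP fz) mulr0 add0r.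
(* [Qdim] selects some dimension, so any other basis is compared with the powers of z in both
   directions. *)
apply: xget_unique; first by exists (fun i : 'I_d => z ^+ i).
move=> n [b hb]; apply/eqP; rewrite eqn_leq.
by rewrite (Qbasis_le hb basis) (Qbasis_le basis hb).
Qed.
End MinimalPolynomial.

(** * Subadditivity of the Weil height *)

Lemma dvdz_le (a b : int) : 0 < b -> (a %| b)%Z -> a <= b.
Proof.
move=> b0 ab; apply: le_trans (ler_norm a) _.
by rewrite -(gtr0_norm b0) -!abszE lez_nat dvdn_leq // absz_gt0 gt_eqF.
Qed.

Lemma Xn_sub1_split (C : closedFieldType) n : (0 < n)%N ->
  exists w : 'I_n -> C, 'X^n - 1 = \prod_j ('X - (w j)%:P).
Proof.
move=> n0; have [t] := closed_field_poly_normal ('X^n - 1 : {poly C}).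
have mon : 'X^n - 1 \is @monic C by rewrite -polyC1 monicXnsubC.
rewrite (monicP mon) scale1r => Et.
have st : size t = n.
  by apply: succn_inj; rewrite -(size_prod_XsubC t id) -Et -polyC1 size_XnsubC.
pose T := Tuple (introT eqP st).
by exists (tnth T); rewrite Et -[t]/(tval T) big_tuple.
Qed.

Section Heights.
Variable R : realType.
Local Notation C := (R[i]).
Local Notation pZtoC := (map_poly (intr : int -> C)).
Local Notation pZtoQ := (map_poly (intr : int -> rat)).
Local Notation pQtoC := (map_poly (ratr : rat -> C)).

Lemma cmodE (z : C) : cmod z = ComplexField.Normc.normc z.
Proof. by []. Qed.

Lemma cmodM (z w : C) : cmod (z * w) = cmod z * cmod w.
Proof. by rewrite !cmodE ComplexField.Normc.normcM. Qed.

Lemma cmod1 : cmod (1 : C) = 1.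
Proof. exact: ComplexField.Normc.normc1. Qed.

Lemma cmodX (z : C) n : cmod (z ^+ n) = cmod z ^+ n.
Proof. by elim: n => [|n IH]; rewrite ?cmod1 // !exprS cmodM IH. Qed.

Lemma cmod_int (c : int) : 0 <= c -> cmod (c%:~R : C) = c%:~R.
Proof.
by case: c => // n _; rewrite /cmod normr_nat -(rmorph_nat (real_complex R)).
Qed.

Lemma cmod_ge0 (z : C) : 0 <= cmod z.
Proof. by rewrite cmodE; case: z => a b; apply: sqrtr_ge0. Qed.

Lemma logp_ge0 (t : R) : 0 <= logp t.
Proof. by rewrite /logp le_max lexx orbT. Qed.

Lemma le_ln_logp (t : R) : ln t <= logp t.
Proof. by rewrite /logp le_max lexx. Qed.

Lemma logpM (s t : R) : 0 <= s -> 0 <= t -> logp (s * t) <= logp s + logp t.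
Proof.
rewrite [0 <= s]le_eqVlt => /predU1P[<- _|s0].
  by rewrite mul0r {1}/logp ln0 // maxxx addr_ge0 ?logp_ge0.
rewrite le_eqVlt => /predU1P[<-|t0].
  by rewrite mulr0 {1}/logp ln0 // maxxx addr_ge0 ?logp_ge0.
rewrite {1}/logp ge_max addr_ge0 ?logp_ge0 // andbT lnM ?posrE //.
by rewrite lerD ?le_ln_logp.
Qed.

Lemma logpX (t : R) n : 0 <= t -> logp t *+ n <= logp (t ^+ n).
Proof.
rewrite le_eqVlt => /predU1P[<-|t0].
  by rewrite {1}/logp ln0 // maxxx mul0rn logp_ge0.
rewrite {1}/logp maxEle; case: ifP => _; first by rewrite mul0rn logp_ge0.
by rewrite -lnXn // le_ln_logp.
Qed.

(** [croots] is one chosen list of roots; unique factorization makes it a permutation of [s]. *)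
Lemma mahlerE (c : C) (s : seq C) : c != 0 ->
  mahler (c *: \prod_(x <- s) ('X - x%:P)) =
  ln (cmod c) + \sum_(x <- s) logp (cmod x).
Proof.
move=> c0; rewrite /mahler lead_coefZ lead_coef_prod_XsubC mulr1; congr (_ + _).
apply: perm_big; rewrite /croots; case: closed_field_poly_normal => t /=.
rewrite lead_coefZ lead_coef_prod_XsubC mulr1 => /(scalerI c0)/prod_XsubC_eq.
by rewrite perm_sym.
Qed.

Lemma mahler_power (f : {poly C}) (s : seq C) k : f != 0 ->
  f ^+ k = lead_coef f ^+ k *: \prod_(x <- s) ('X - x%:P) ->
  mahler f *+ k = ln (cmod (lead_coef f)) *+ k + \sum_(x <- s) logp (cmod x).
Proof.
move=> f0; have l0 : lead_coef f != 0 by rewrite lead_coef_eq0.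
have [t Ef] := closed_field_poly_normal f.
set l := lead_coef f in l0 Ef *.
rewrite Ef mahlerE // mulrnDl exprZn => /scalerI E; congr (_ + _).
have [u Eu Su] : exists2 u : seq C,
    \prod_(x <- u) ('X - x%:P) = (\prod_(x <- t) ('X - x%:P)) ^+ k &
    \sum_(x <- u) logp (cmod x) = (\sum_(x <- t) logp (cmod x)) *+ k.
  elim: k {E} => [|k [u Eu Su]]; first by exists [::]; rewrite !big_nil.
  by exists (t ++ u); rewrite big_cat /= ?Eu ?Su ?exprS ?mulrS.
rewrite -Su; apply: perm_big; apply: prod_XsubC_eq; rewrite Eu.
by apply: E; rewrite expf_neq0.
Qed.

Lemma is_minpolyZ_lead_gt0 (z : C) p : is_minpolyZ z p -> 0 < lead_coef p.
Proof.
by case=> p1 _ _; rewrite -sgz_gt0 -sgz_contents p1.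
Qed.

(** All elements A(g) of one field Q(g) are measured over the same list [s] of conjugates of g, so
    their heights can be compared term by term. L is the least positive integer that clears the
    denominators of the product; the exponent n serves [weil_heightX]. *)
Lemma weil_height_conjugates (m A : {poly rat}) (s : seq C) (g z : C) :
  algebraic_number z -> m \is monic -> irreducible_poly m ->
  root (pQtoC m) g -> (pQtoC A).[g] = z ->
  pQtoC m = \prod_(x <- s) ('X - x%:P) ->
  exists L : int, [/\ 0 < L,
    integral_coefs (L%:~R *: \prod_(x <- s) ('X - ((pQtoC A).[x])%:P)),
    forall (c : int) n,
      integral_coefs (c%:~R *: (\prod_(x <- s) ('X - ((pQtoC A).[x])%:P)) ^+ n) ->
      (L ^+ n %| c)%Z &
    (size s)%:R * weil_height z =
      ln (L%:~R) + \sum_(x <- s) logp (cmod (pQtoC A).[x])].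
Proof.
move=> zalg mm mirr mg Ez Em.
have := minpolyZP zalg; rewrite /weil_height /mahler_num.
move: (minpolyZ z) => f hf; have l0 := is_minpolyZ_lead_gt0 hf.
have [f1 firr fz] := hf; have {}firr := irreducible_polyZ_rat firr fz.
have rz : root (pQtoC (pZtoQ f)) z by rewrite map_ratr_intr.
rewrite (alg_degreeE firr rz) size_rat_int_poly.
have [k Ek] : exists k, pZtoC f ^+ k =
    ((lead_coef f)%:~R ^+ k) *: \prod_(x <- s) ('X - ((pQtoC A).[x])%:P).
  by apply: (conjugates_power f1 firr mm mirr mg _ Em); rewrite Ez.
have lf : lead_coef (pZtoC f) = (lead_coef f)%:~R by rewrite lead_coef_map_inj //; exact: intr_inj.
have sf : size (pZtoC f) = size f by rewrite size_map_inj_poly //; exact: intr_inj.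
have f0 : pZtoC f != 0 by rewrite -lead_coef_eq0 lf intr_eq0 gt_eqF.
exists (lead_coef f ^+ k); split.
- by rewrite exprn_gt0.
- rewrite rmorphXn /= -Ek; rewrite -rmorphXn; exact: integral_coefs_map_intr.
- move=> c n hc; rewrite -exprM; exact: (primitive_lead_dvd f1 Ek hc).
(* Comparing degrees gives size s = k deg f, so that (size s) h(z) is k times the Mahler measure of
   f. *)
have sk : size s = ((size f).-1 * k)%N.
  have := congr1 (fun p : {poly C} => (size p).-1) Ek.
  rewrite size_exp sf size_scale ?size_prod_XsubC //.
  by rewrite expf_neq0 // intr_eq0 gt_eqF.
have d0 : ((size f).-1)%:R != 0 :> R.
  rewrite pnatr_eq0 -lt0n -ltnS prednK ?size_poly_gt0 -1?(size_rat_int_poly f) ?firr.1 //.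
  by rewrite -lead_coef_eq0 gt_eqF.
rewrite sk natrM mulrC mulrA divfK // mulr_natr.
rewrite (@mahler_power _ [seq (pQtoC A).[x] | x <- s]) //; last by rewrite lf Ek big_map.
rewrite big_map lf cmod_int ?ltW //; congr (_ + _).
by rewrite -lnXn ?ltr0z // rmorphXn.
Qed.

Lemma minpoly_roots (g : C) : algebraic_number g ->
  exists (m : {poly rat}) (s : seq C), [/\ m \is monic, irreducible_poly m,
    root (pQtoC m) g, pQtoC m = \prod_(x <- s) ('X - x%:P) & (0 < size s)%N].
Proof.
case/minpoly_exists => m [mm mirr mg]; exists m.
have [s Es] := closed_field_poly_normal (pQtoC m).
rewrite lead_coef_map (monicP mm) rmorph1 scale1r in Es.
exists s; split=> //.
by rewrite -ltnS -(size_prod_XsubC s id) -Es size_map_poly mirr.1.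
Qed.

Lemma weil_heightM (y z : C) : algebraic_number y -> algebraic_number z ->
  weil_height (y * z) <= weil_height y + weil_height z.
Proof.
move=> ya za.
(* A primitive element of Q(y, z), of the form n z - y. *)
have [g ga [[A Ey] [B Ez]]] : exists2 g : C, algebraic_number g &
    (exists A, (pQtoC A).[g] = y) /\ (exists B, (pQtoC B).[g] = z).
  have [p p0 py] := ya; have [q q0 qz] := za.
  have [n [hy hz]] := pchar0_PET p0 py q0 qz (@pchar_num _).
  exists (z *+ n - y) => //; apply: algebraic_sub ya.
  by rewrite -mulr_natr; apply: algebraic_mul za _; rewrite -(ratr_nat C n); apply: algebraic_id.
have [m [s [mm mirr mg Em s0]]] := minpoly_roots ga.
have [L [L0 LI _ hL]] := weil_height_conjugates ya mm mirr mg Ey Em.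
have [M [M0 MI _ hM]] := weil_height_conjugates za mm mirr mg Ez Em.
have Eyz : (pQtoC (A * B)).[g] = y * z by rewrite rmorphM hornerM Ey Ez.
have [N [N0 _ Ndvd hN]] :=
  weil_height_conjugates (algebraic_mul ya za) mm mirr mg Eyz Em.
(* L M clears the denominators for the products of conjugates, by [integral_coefs_prodM], so N
   divides L M. *)
have LMN : ln (N%:~R : R) <= ln L%:~R + ln M%:~R.
  rewrite -lnM ?posrE ?ltr0z // ler_ln ?posrE ?mulr_gt0 ?ltr0z // -rmorphM ler_int.
  apply: dvdz_le; first by rewrite mulr_gt0.
  rewrite -[N]expr1; apply: Ndvd; rewrite rmorphM expr1 /=.
  move: LI MI; rewrite !(big_tnth _ _ s) => LI MI.
  under eq_bigr do rewrite rmorphM hornerM.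
  exact: integral_coefs_prodM LI MI.
rewrite -(ler_pM2l (_ : 0 < (size s)%:R)) ?ltr0n // mulrDr hL hM hN addrACA lerD //.
rewrite -big_split; apply: ler_sum => x _.
by rewrite rmorphM hornerM cmodM logpM ?cmod_ge0.
Qed.

(** Over the conjugates of y, take A = X for y and A = X^n for y^n. By [integral_coefs_prod_roots],
    L clears the denominators of the n-th power of the polynomial for y, so M^n divides L. *)
Lemma weil_heightX (y : C) n : (0 < n)%N -> algebraic_number y ->
  weil_height y *+ n <= weil_height (y ^+ n).
Proof.
move=> n0 ya; have [m [s [mm mirr my Em s0]]] := minpoly_roots ya.
have zXn (z : C) : (pQtoC 'X^n).[z] = z ^+ n by rewrite map_polyXn hornerXn.
have zX (z : C) : (pQtoC 'X).[z] = z by rewrite map_polyX hornerX.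
have yna : algebraic_number (y ^+ n).
  elim: n {n0 zXn} => [|n IH]; first exact: algebraic1.
  by rewrite exprS; apply: algebraic_mul.
have [L [L0 LI _ hL]] := weil_height_conjugates yna mm mirr my (zXn y) Em.
have [M [M0 _ Mdvd hM]] := weil_height_conjugates ya mm mirr my (zX y) Em.
have LM : ln (M%:~R : R) *+ n <= ln L%:~R.
  rewrite -lnXn ?ltr0z // ler_ln ?posrE ?exprn_gt0 ?ltr0z // -rmorphXn ler_int.
  apply: dvdz_le => //; apply: Mdvd.
  under eq_bigr do rewrite zX.
  move: LI; under eq_bigr do rewrite zXn.
  rewrite !(big_tnth _ _ s) => LI.
  by apply: integral_coefs_prod_roots LI => //; apply: Xn_sub1_split.
rewrite -(ler_pM2l (_ : 0 < (size s)%:R)) ?ltr0n // mulrnAr hL hM mulrnDl lerD //.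
rewrite -sumrMnl; apply: ler_sum => x _.
by rewrite zX zXn cmodX logpX // cmod_ge0.
Qed.

Lemma weil_height_ge0 (z : C) : algebraic_number z -> 0 <= weil_height z.
Proof.
move=> za; have [m [s [mm mirr mz Em s0]]] := minpoly_roots za.
have zX : (pQtoC 'X).[z] = z by rewrite map_polyX hornerX.
have [L [L0 _ _ hL]] := weil_height_conjugates za mm mirr mz zX Em.
rewrite -(pmulr_rge0 _ (_ : 0 < (size s)%:R)) ?ltr0n // hL addr_ge0 //.
  by rewrite ln_ge0 // -[1]/(1%:~R) ler_int.
by apply: sumr_ge0 => x _; apply: logp_ge0.
Qed.

(** The case n = 2 of [weil_heightX] reads 2 h(1) <= h(1). *)
Lemma weil_height1 : weil_height (1 : C) = 0.
Proof.
apply/eqP; rewrite eq_le weil_height_ge0 ?andbT; last exact: algebraic1.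
have := @weil_heightX 1 2 isT (algebraic1 _).
by rewrite expr1n mulr2n gerDl.
Qed.

End Heights.

(** * Metric heights *)

Section MetricHeight.
Variable R : realType.
Local Notation C := (R[i]).
Implicit Types (a : nat -> C) (y z : C).

Lemma algseq_eventually1 a : algseq a -> exists M, forall n, (M <= n)%N -> a n = 1.
Proof.
case=> _ /finite_seqP[s Es]; exists (\max_(i <- s) i).+1 => n.
apply: contraTeq => an; rewrite -leqNgt.
have : [set n | a n != 1]%classic n by [].
by rewrite Es /= => ns; apply: (@leq_bigmax_seq _ s predT id n).
Qed.

Lemma tau_eventually1 a M : (forall n, (M <= n)%N -> a n = 1) ->
  tau a = \prod_(n < M) a n.
Proof.
move=> aM; rewrite fsbig_ord; apply/esym/fsbig_widen => // n [_] /= /negP.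
by rewrite -leqNgt => /aM.
Qed.

(** The partial sums are constant from [M] on, because h(1) = 0 and 0^r = 0 for non-zero r. *)
Lemma height_seq_eventually1 a M (r : R) : r != 0 ->
  (forall n, (M <= n)%N -> a n = 1) ->
  height_seq r%:E a = (\sum_(n < M) weil_height (a n) `^ r) `^ r^-1.
Proof.
move=> r0 aM; rewrite /height_seq; congr (_ `^ _); apply: lim_near_cst; first exact: norm_hausdorff.
near=> n; rewrite /series /= (@big_cat_nat _ _ _ M) //=; last by near: n; exists M.
rewrite [X in _ + X]big_nat_cond [X in _ + X]big1 ?addr0 ?big_mkord // => k.
by rewrite andbT => /andP[/aM -> _]; rewrite weil_height1 powR0.
Unshelve. all: by end_near. Qed.

Lemma weil_height_prod a M : (forall n, algebraic_number (a n)) ->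
  weil_height (\prod_(n < M) a n) <= \sum_(n < M) weil_height (a n).
Proof.
move=> aa; suff : algebraic_number (\prod_(n < M) a n) /\
  weil_height (\prod_(n < M) a n) <= \sum_(n < M) weil_height (a n) by case.
elim: M => [|M [IHa IH]].
  by rewrite !big_ord0 weil_height1; split=> //; apply: algebraic1.
rewrite !big_ord_recr /=; split; first exact: (algebraic_mul IHa (aa M)).
by apply: le_trans (weil_heightM IHa (aa M)) _; rewrite lerD2r.
Qed.

(** With T = S^(1/r), every F_i is at most T, so F_i = F_i^r F_i^(1-r) <= F_i^r T^(1-r). Summing
    gives the bound S T^(1-r) = T. *)
Lemma sum_le_powR (I : finType) (F : I -> R) (r : R) :
  (forall i, 0 <= F i) -> 0 < r -> r <= 1 ->
  \sum_i F i <= (\sum_i F i `^ r) `^ r^-1.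
Proof.
move=> F0 r0 r1; set S := \sum_i F i `^ r.
have S0 : 0 <= S by apply: sumr_ge0 => i _; apply: powR_ge0.
have rV : 1 <= r^-1 by rewrite invf_ge1.
have FS i : F i <= S `^ r^-1.
  rewrite -[F i]powRr1 // -(mulfV (lt0r_neq0 r0)) powRrM.
  apply: ge0_ler_powR; rewrite ?nnegrE ?invr_ge0 ?powR_ge0 ?(ltW r0) //.
  by rewrite /S (bigD1 i) //= lerDl; apply: sumr_ge0 => j _; apply: powR_ge0.
have FS' i : F i <= F i `^ r * S `^ (r^-1 - 1).
  have -> : S `^ (r^-1 - 1) = (S `^ r^-1) `^ (1 - r).
    by rewrite -powRrM mulrBr mulr1 mulVf // lt0r_neq0.
  have [Fi0|Fi0] := eqVneq (F i) 0; first by rewrite Fi0 mulr_ge0 ?powR_ge0.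
  rewrite -{1}[F i]powRr1 // -{1}(subrK r 1) addrC powRD ?Fi0 ?implybT //.
  rewrite ler_wpM2l ?powR_ge0 // ge0_ler_powR ?nnegrE ?subr_ge0 ?powR_ge0 //.
apply: le_trans (ler_sum _ (fun i _ => FS' i)) _.
rewrite -mulr_suml -/S; have [->|S1] := eqVneq S 0; first by rewrite mul0r powR_ge0.
by rewrite -{1}[S]powRr1 // -powRD ?S1 ?implybT // addrC subrK.
Qed.

(** With n = 1 this is the trivial preimage of y under [tau]; with y an n-th root of alpha it is a
    preimage of alpha whose height is small when x > 1. *)
Definition const_seq y n : nat -> C := fun k => if (k < n)%N then y else 1.

Lemma const_seq_ge y n k : (n <= k)%N -> const_seq y n k = 1.
Proof. by rewrite /const_seq leqNgt => /negPf->. Qed.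

Lemma algseq_const_seq y n : algebraic_number y -> y != 0 -> algseq (const_seq y n).
Proof.
move=> ya y0; split=> [k|].
  by rewrite /const_seq; case: ifP => _ //; rewrite oner_neq0; split=> //; apply: algebraic1.
apply: sub_finite_set (finite_II n) => k /=; apply: contraNT; rewrite -leqNgt.
by move=> /const_seq_ge ->.
Qed.

Lemma tau_const_seq y n : tau (const_seq y n) = y ^+ n.
Proof.
rewrite (tau_eventually1 (@const_seq_ge y n)).
by under eq_bigr do rewrite /const_seq ltn_ord; rewrite prodr_const card_ord.
Qed.

Lemma height_const_seq y n (r : R) : r != 0 ->
  height_seq r%:E (const_seq y n) = (n%:R * weil_height y `^ r) `^ r^-1.
Proof.
move=> r0; rewrite (height_seq_eventually1 r0 (@const_seq_ge y n)).
under eq_bigr do rewrite /const_seq ltn_ord.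
by rewrite sumr_const card_ord mulr_natl.
Qed.

Lemma height_seq_ge0 x a : algseq a -> 0 <= height_seq x a.
Proof.
move=> ha; have h0 n : 0 <= weil_height (a n).
  by apply: weil_height_ge0; have [/(_ n)[]] := ha.
have sup0 : 0 <= sup (range (fun n => weil_height (a n))).
  (* A set without a supremum gets the default value 0, so both cases give the bound. *)
  have [[ne ub]|/sup_out->//] := pselect (has_sup (range (fun n => weil_height (a n)))).
  by apply: le_trans (h0 0%N) _; apply: ub_le_sup => //; exists 0%N.
by case: x => [r||] //=; apply: powR_ge0.
Qed.

Lemma metric_height_le x a z : algseq a -> tau a = z ->
  metric_height x z <= height_seq x a.
Proof.
move=> ha az; apply: ge_inf; last by exists a.
by exists 0 => _ [b [hb _] <-]; apply: height_seq_ge0.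
Qed.

Lemma le_metric_height x z e : algebraic_number z -> z != 0 ->
  (forall a, algseq a -> tau a = z -> e <= height_seq x a) ->
  e <= metric_height x z.
Proof.
move=> za z0 h; apply: lb_le_inf => [|_ [a [ha az] <-]]; last exact: h.
(* [lb_le_inf] asks for a non-empty set; (z, 1, 1, ...) supplies a member. *)
exists (height_seq x (const_seq z 1)), (const_seq z 1) => //; split.
  exact: algseq_const_seq.
by rewrite tau_const_seq expr1.
Qed.

Lemma algebraic_root z y n : (0 < n)%N -> algebraic_number z -> y ^+ n = z ->
  algebraic_number y.
Proof.
move=> n0 za yz; apply/integral_algebraic.
apply: (@integral_root _ _ _ ('X^n - z%:P)).
- exact/monic_neq0/monicXnsubC.
- by rewrite /root !hornerE yz subrr.
- apply/integral_poly => i; rewrite coefB coefXn coefC.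
  apply: integral_sub; first exact: integral_nat.
  by case: eqP => _; [apply/integral_algebraic | apply: mxpoly.integral0].
Qed.

(** If e were positive, an integer n above (h/e)^(1/s) would make e n^s exceed h. This replaces a
    passage to the limit when x > 1. *)
Lemma powR_bounded_le0 (e h s : R) : 0 < s ->
  (forall n : nat, (0 < n)%N -> e * n%:R `^ s <= h) -> e <= 0.
Proof.
move=> s0 H; rewrite leNgt; apply/negP => e0.
have h0 : 0 <= h / e.
  by rewrite divr_ge0 ?(ltW e0) // (le_trans _ (H 1%N _)) // mulr_ge0 ?powR_ge0 ?ltW.
set n := (Num.truncn ((h / e) `^ s^-1)).+1.
have : (h / e) `^ s^-1 < n%:R by rewrite truncnS_gt.
move=> /(gt0_ltr_powR s0); rewrite !nnegrE powR_ge0 ler0n => /(_ isT isT).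
rewrite -powRrM mulVf ?lt0r_neq0 // powRr1 // ltr_pdivrMr // mulrC.
by rewrite ltNge H.
Qed.

End MetricHeight.

Theorem theorem1p6 (R : realType) (alpha : R[i]) (x : \bar R)
    (halpha : algebraic_number alpha) (halpha0 : alpha != 0)
    (hx : (0 < x)%E) :
  metric_height x alpha = if (x <= 1)%E then weil_height alpha else 0.
Proof.
case: ifPn => [x1|]; last rewrite -ltNge => x1; apply/eqP; rewrite eq_le; apply/andP; split.
- case: x hx x1 => [r| |] //; rewrite lte_fin lee_fin => r0 r1.
  have := metric_height_le r%:E (algseq_const_seq 1 halpha halpha0) (tau_const_seq alpha 1).
  rewrite height_const_seq ?lt0r_neq0 // mul1r -powRrM mulfV ?lt0r_neq0 //.
  by rewrite powRr1 ?weil_height_ge0.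
- case: x hx x1 => [r| |] //; rewrite lte_fin lee_fin => r0 r1.
  apply: le_metric_height => // a ha <-; have [M aM] := algseq_eventually1 ha.
  have aa n : algebraic_number (a n) by have [/(_ n)[]] := ha.
  rewrite (tau_eventually1 aM) (height_seq_eventually1 _ aM) ?lt0r_neq0 //.
  apply: le_trans (weil_height_prod M aa) _.
  by apply: sum_le_powR => // i; apply: weil_height_ge0.
(* For x > 1, any n-th root y of alpha satisfies n h(y) <= h(alpha). *)
- have root n : (0 < n)%N -> exists y, [/\ y ^+ n = alpha, algebraic_number y,
      y != 0 & weil_height y * n%:R <= weil_height alpha].
    move=> n0; exists (n.-root alpha); have E := rootCK n0 alpha.
    have ya := algebraic_root n0 halpha E; split=> //.
      by apply: contraNneq halpha0 => y0; rewrite -E y0 expr0n gtn_eqF.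
    by rewrite mulr_natr -{2}E weil_heightX.
  case: x hx x1 => [r| |] //.
    rewrite lte_fin => r0; rewrite lte_fin => r1.
    have s0 : 0 < 1 - r^-1 by rewrite subr_gt0 invf_lt1.
    apply: (powR_bounded_le0 (h := weil_height alpha) s0) => n n0.
    have [y [yn ya y0 hy]] := root n n0; have h0 := weil_height_ge0 ya.
    apply: le_trans hy.
    (* The n copies of y have height n^(1/r) h(y); multiplying by n^(1 - 1/r) gives n h(y). *)
    have En : n%:R = n%:R `^ r^-1 * n%:R `^ (1 - r^-1) :> R.
      by rewrite -powRD ?pnatr_eq0 -?lt0n ?n0 ?implybT // addrC subrK powRr1.
    rewrite [X in _ <= _ * X]En mulrA ler_wpM2r ?powR_ge0 //.
    have := metric_height_le r%:E (algseq_const_seq n ya y0) (tau_const_seq y n).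
    rewrite yn height_const_seq ?lt0r_neq0 // powRM ?powR_ge0 // -powRrM mulfV ?lt0r_neq0 //.
    by rewrite powRr1 // mulrC.
  (* For x infinite, the n copies of y have height at most h(y), so the exponent is 1. *)
  move=> _ _; apply: (powR_bounded_le0 (h := weil_height alpha) ltr01) => n n0.
  have [y [yn ya y0 hy]] := root n n0; rewrite powRr1 //.
  apply: le_trans hy; rewrite ler_wpM2r //.
  have := metric_height_le +oo%E (algseq_const_seq n ya y0) (tau_const_seq y n).
  rewrite yn => /le_trans; apply; apply: ge_sup.
    by exists (weil_height (const_seq y n 0)), 0%N.
  move=> _ [k _ <-]; rewrite /const_seq; case: ifP => // _.
  by rewrite weil_height1 weil_height_ge0.
- by apply: le_metric_height => // a ha _; apply: height_seq_ge0.
Qed.
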